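(* For every BST $T$ on $n$ keys there is a query sequence $S(T)$ with $$|S(T)|\le\min\Big(3n\big(d(T)-\lfloor\lg n\rfloor+1\big),\ \tfrac32 n(n-1)\Big),$$ in particular $|S(T)|=O(n\cdot d(T))$, such that the following holds. For every initial BST $T_0$ on the same keys and every query sequence $Y$, when $GF$ serves the concatenation $S(T)\circ Y$ starting from $T_0$, the tree it holds right after serving the last query of $S(T)$ is exactly $T$.
   Context: $d(T)$ is the maximum, over nodes $v$, of the number of edges from the root to $v$. $\lg$ is the base-2 logarithm. Binary search tree model. An algorithm serving a query sequence $X=[x_1,\dots,x_m]$ holds a BST $T_{t-1}$ before serving $x_t$, searches $x_t$ from the root, and may then restructure by rotations into $T_t$. Greedy Future ($GF$). After finding $x_t$ in $T_{t-1}$, let $v_1<\dots<v_k$ be the keys on the root-to-$x_t$ path, set $v_0=-\infty$ and $v_{k+1}=+\infty$, and let $R_0,\dots,R_k$ be the subtrees hanging off this path. For each $i$, $\tau(v_i)$ is the smallest $s>t$ with $x_s\in(v_{i-1},v_{i+1})$, or $+\infty$ if there is none. $GF$ rearranges $v_1,\dots,v_k$ as a treap: a BST in key order and a heap in $\tau$, with the smallest $\tau$ at the top. Ties in $\tau$ are broken in favor of the node of smaller depth in $T_{t-1}$. It then reattaches $R_0,\dots,R_k$ unchanged at their unique positions, giving $T_t$. *)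

(* Defs.v *)
From mathcomp Require Import all_boot.
Set Implicit Arguments. Unset Strict Implicit. Unset Printing Implicit Defensive.

Inductive tree := Leaf | Node of tree & nat & tree.

Fixpoint inorder (t : tree) : seq nat :=
  if t is Node l k r then inorder l ++ k :: inorder r else [::].

Definition is_bst (t : tree) : bool := sorted ltn (inorder t).

Definition nkeys (t : tree) : nat := size (inorder t).

Fixpoint depth (t : tree) : nat :=
  if t is Node l _ r then
    maxn (if l is Node _ _ _ then (depth l).+1 else 0)
         (if r is Node _ _ _ then (depth r).+1 else 0)
  else 0.

(* Search for x from the root (the root has depth d).  Returns the keys
   v_1 < ... < v_k on the search path, each paired with its depth in the
   tree, and the subtrees R_0, ..., R_k hanging off the path, in key order
   (size of the second list = size of the first + 1). *)
Fixpoint path_split (x : nat) (t : tree) (d : nat) : seq (nat * nat) * seq tree :=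
  match t with
  | Leaf => ([::], [:: Leaf])
  | Node l k r =>
      if x == k then ([:: (k, d)], [:: l; r])
      else if x < k then
        let p := path_split x l d.+1 in (rcons p.1 (k, d), rcons p.2 r)
      else
        let p := path_split x r d.+1 in ((k, d) :: p.1, l :: p.2)
  end.

Definition in_open (lo hi : option nat) (x : nat) : bool :=
  (if lo is Some a then a < x else true) && (if hi is Some b then x < b else true).

(* queries are 0-indexed: X = [x_0; x_1; ...].  next_time X t lo hi is the
   smallest s > t with x_s in (lo, hi), or None (= +oo). *)
Definition next_time (X : seq nat) (t : nat) (lo hi : option nat) : option nat :=
  let Z := drop t.+1 X in
  let j := find (in_open lo hi) Z in
  if j < size Z then Some (t.+1 + j) else None.

(* priority (tau, depth), compared lexicographically, None = +oo *)
Definition prio := (option nat * nat)%type.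

Definition lt_prio (p q : prio) : bool :=
  match p.1, q.1 with
  | Some a, Some b => (a < b) || ((a == b) && (p.2 < q.2))
  | Some _, None => true
  | None, Some _ => false
  | None, None => p.2 < q.2
  end.

Definition argmin (ks : seq (nat * prio)) : nat :=
  find (fun e => all (fun e' => ~~ lt_prio e'.2 e.2) ks) ks.

(* treap on keys ks (in key order, with priorities) with the subtrees subs
   attached at their positions (size subs = size ks + 1); fuel is only a
   termination device, size ks + 1 suffices *)
Fixpoint build (fuel : nat) (ks : seq (nat * prio)) (subs : seq tree) : tree :=
  match fuel with
  | 0 => Leaf
  | fuel'.+1 =>
      if ks is [::] then head Leaf subs else
      let j := argmin ks in
      Node (build fuel' (take j ks) (take j.+1 subs))
           (nth 0 (unzip1 ks) j)
           (build fuel' (drop j.+1 ks) (drop j.+1 subs))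
  end.

Definition gf_step (X : seq nat) (t : nat) (T : tree) : tree :=
  let ps := path_split (nth 0 X t) T 0 in
  let vs := ps.1 in
  let k := size vs in
  let key i := (nth (0, 0) vs i).1 in
  let pr := mkseq (fun i =>
      (key i,
       (next_time X t (if i == 0 then None else Some (key i.-1))
                      (if i.+1 == k then None else Some (key i.+1)),
        (nth (0, 0) vs i).2))) k in
  build k.+1 pr ps.2.

Fixpoint gf_run (X : seq nat) (T0 : tree) (m : nat) : tree :=
  if m is m'.+1 then gf_step X m' (gf_run X T0 m') else T0.

(* Main.v *)
Require Import Defs.
From mathcomp Require Import all_boot.
From mathcomp Require Import zify.

(** Process the keys k of T children first, skipping the leaves.  Let lo < k < hi
    be the nearest ancestors of k in T on either side.  Querying k, k, lo, hi
    brings k to the root, and then lo, hi onto a search path together with k.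
    Such a path meets (lo, k) at most in the root w of the left subtree of k,
    because both subtrees of w have already been assembled below it and stay
    intact under queries outside their gaps.  Later queries of the script reach
    lo and k again before anything in (lo, k), so w sinks below both of them and
    the left subtree of k is complete in (lo, k); symmetrically in (k, hi).

    The script has at most 4 (n - leaves) - 2 queries.  This is at most 4 n,
    which is enough if d > floor (lg n); if d = floor (lg n), then at least a
    quarter of the nodes are leaves. *)

Set Implicit Arguments.
Unset Strict Implicit.
Unset Printing Implicit Defensive.

(** * Search trees and the subtrees spanning their gaps *)

Lemma bst_node l k r : is_bst (Node l k r) ->
  [/\ is_bst l, is_bst r, {in inorder l, forall y, y < k}
    & {in inorder r, forall y, k < y}].
Proof.
rewrite /is_bst /= !(sorted_pairwise ltn_trans) pairwise_cat /=.
case/and3P => /allrelP lr sl /andP[/allP kr sr]; split => // y yl.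
by apply: lr; rewrite // inE eqxx.
Qed.

Lemma mem_node l k r y :
  (y \in inorder (Node l k r)) = [|| y == k, y \in inorder l | y \in inorder r].
Proof. by rewrite /= mem_cat inE orbCA. Qed.

Lemma inorder_nil t : inorder t = [::] -> t = Leaf.
Proof. by case: t => // l k r /=; case: (inorder l). Qed.

(* The highest subtree of a BST whose root lies in the gap (lo, hi); it contains
   every key of the gap, and is said to be isolated if it contains no other. *)
Fixpoint cut (lo hi : option nat) (t : tree) : tree :=
  if t is Node l k r then
    if in_open lo hi k then t
    else if in_open lo None k then cut lo hi l else cut lo hi r
  else Leaf.


Lemma in_openE lo hi y : in_open lo hi y = in_open lo None y && in_open None hi y.
Proof. by rewrite /in_open andbT. Qed.

Lemma cutE lo hi l k r : cut lo hi (Node l k r) =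
  if in_open lo hi k then Node l k r
  else if in_open lo None k then cut lo hi l else cut lo hi r.
Proof. by []. Qed.

Arguments in_open : simpl never.
Ltac open_lia lo hi := unfold in_open in *; destruct lo, hi; simpl in *; lia.

Lemma cut_sub lo hi t : {subset inorder (cut lo hi t) <= inorder t}.
Proof.
elim: t => [|l IHl k r IHr] //; rewrite cutE; case: ifP => _ y //.
by case: ifP => _ yt; rewrite mem_node ?(IHl _ yt) ?(IHr _ yt) ?orbT.
Qed.

Lemma mem_cut lo hi t y : is_bst t -> y \in inorder t -> in_open lo hi y ->
  y \in inorder (cut lo hi t).
Proof.
elim: t => [|l IHl k r IHr] // /bst_node[bl br lk rk].
rewrite mem_node cutE; case: ifP => [_ H _|kNo]; first by rewrite mem_node.
case/or3P => [/eqP->|yl|yr] yo; first by rewrite kNo in yo.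
- by rewrite ifT ?IHl //; have := lk _ yl; clear IHl IHr; open_lia lo hi.
- by rewrite ifF ?IHr //; have := rk _ yr; clear IHl IHr; open_lia lo hi.
Qed.

Lemma cut_id lo hi t : {in inorder t, forall y, in_open lo hi y} ->
  cut lo hi t = t.
Proof. by case: t => // l k r H; rewrite /= H ?mem_node ?eqxx. Qed.

Lemma cut_leaf lo hi t : {in inorder t, forall y, ~~ in_open lo hi y} ->
  cut lo hi t = Leaf.
Proof.
elim: t => [|l IHl k r IHr] // H /=.
rewrite (negPf (H k _)) ?mem_node ?eqxx //.
case: ifP => _; [apply: IHl|apply: IHr] => y yt;
  by apply: H; rewrite mem_node yt ?orbT.
Qed.

(** A root outside (lo, hi) lies on the same side of the smaller gap, so both descents take the same
    turns until the larger one stops. *)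
Lemma cut_cutl lo hi w t : in_open lo hi w ->
  cut lo (Some w) (cut lo hi t) = cut lo (Some w) t.
Proof.
move=> wo; elim: t => [|l IHl k r IHr] //=; case: ifP => // kNo.
have ->: in_open lo (Some w) k = false by clear IHl IHr; open_lia lo hi.
by case: ifP.
Qed.

Lemma cut_cutr lo hi w t : in_open lo hi w ->
  cut (Some w) hi (cut lo hi t) = cut (Some w) hi t.
Proof.
move=> wo; elim: t => [|l IHl k r IHr] //=; case: ifP => // kNo.
have ->: in_open (Some w) hi k = false by clear IHl IHr; open_lia lo hi.
have ->: in_open (Some w) None k = in_open lo None k by clear IHl IHr; open_lia lo hi.
by case: ifP.
Qed.

Lemma bst_cut lo hi t : is_bst t -> is_bst (cut lo hi t).
Proof.
elim: t => [|l IHl k r IHr] //= bt; have [bl br _ _] := bst_node bt.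
by case: ifP => // _; case: ifP => _; auto.
Qed.

Definition iso lo hi t := {in inorder (cut lo hi t), forall y, in_open lo hi y}.

(** A root other than [w] would lie in one of the two smaller gaps; the cut for that gap would then
    be all of [t] and contain [w], against isolation. *)
Lemma glue lo hi w t : is_bst t -> {in inorder t, forall y, in_open lo hi y} ->
  w \in inorder t -> iso lo (Some w) t -> iso (Some w) hi t ->
  t = Node (cut lo (Some w) t) w (cut (Some w) hi t).
Proof.
case: t => // l k r bt allo wt isol isor.
have ko := allo k; rewrite mem_node eqxx in ko; have {}ko := ko isT.
have [bl br lk rk] := bst_node bt.
case: (ltngtP k w) => [kw|wk|ekw].
- have ko' : in_open lo (Some w) k by open_lia lo hi.
  move: isol; rewrite /iso cutE ko' => /(_ _ wt); open_lia lo hi.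
- have ko' : in_open (Some w) hi k by open_lia lo hi.
  move: isor; rewrite /iso cutE ko' => /(_ _ wt); open_lia lo hi.
- subst w; rewrite !cutE.
  have ->: in_open lo (Some k) k = false by open_lia lo hi.
  have ->: in_open (Some k) hi k = false by open_lia lo hi.
  have ->: in_open (Some k) None k = false by open_lia lo hi.
  have ->: in_open lo None k by open_lia lo hi.
  have yo y : y \in inorder l \/ y \in inorder r -> in_open lo hi y.
    by move=> yt; apply: allo; rewrite mem_node; case: yt => ->; rewrite !orbT.
  rewrite !cut_id // => y yt.
    by have := rk _ yt; have := yo _ (or_intror yt); open_lia lo hi.
  by have := lk _ yt; have := yo _ (or_introl yt); open_lia lo hi.
Qed.

(** * Trees as a top part with subtrees hanging off it *)

(** The in-order sequence of any tree assembled from top keys [ks] and hanging subtrees [ss]. It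
    ignores the shape of the top part, which is why restructuring preserves the keys. *)
Fixpoint weave (ks : seq nat) (ss : seq tree) : seq nat :=
  if ss is s :: ss' then
    inorder s ++ (if ks is k :: ks' then k :: weave ks' ss' else [::])
  else [::].

Lemma weave_cat k ks1 ks2 ss1 ss2 : size ss1 = (size ks1).+1 ->
  weave (ks1 ++ k :: ks2) (ss1 ++ ss2) = weave ks1 ss1 ++ k :: weave ks2 ss2.
Proof.
elim: ks1 ss1 => [|k1 ks1 IH] [|s ss1] //=; first by case: ss1; rewrite //= cats0.
by case=> /IH ->; rewrite -catA.
Qed.

Section Decomp.
Variables (A : eqType) (R : rel A).

(* t is a tree on the keys ks, heap-ordered by the strict order R on their labels
   (no constraint if R is empty), with the subtrees ss attached in key order. *)
Inductive decomp : tree -> seq (nat * A) -> seq tree -> Prop :=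
| DLeaf s : decomp s [::] [:: s]
| DNode a k p b ks1 ks2 ss1 ss2 :
    decomp a ks1 ss1 -> decomp b ks2 ss2 ->
    {in ks1 ++ (k, p) :: ks2, forall e, ~~ R e.2 p} ->
    decomp (Node a k b) (ks1 ++ (k, p) :: ks2) (ss1 ++ ss2).

Lemma size_decomp t ks ss : decomp t ks ss -> size ss = (size ks).+1.
Proof.
elim=> // a k p b ks1 ks2 ss1 ss2 _ IH1 _ IH2 _.
by rewrite !size_cat IH1 IH2 /= addSn.
Qed.

Lemma subseq_decomp t ks ss : decomp t ks ss -> subseq (unzip1 ks) (inorder t).
Proof.
elim=> [s|a k p b ks1 ks2 ss1 ss2 _ IH1 _ IH2 _]; first exact: sub0seq.
by rewrite /unzip1 map_cat cat_subseq //= eqxx.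
Qed.

Lemma decomp_sub t ks ss : decomp t ks ss -> {subset unzip1 ks <= inorder t}.
Proof. by move/subseq_decomp/mem_subseq. Qed.

Lemma inorder_decomp t ks ss : decomp t ks ss -> inorder t = weave (unzip1 ks) ss.
Proof.
elim=> [s|a k p b ks1 ks2 ss1 ss2 d1 IH1 _ IH2 _] /=; first by rewrite cats0.
by rewrite /unzip1 map_cat weave_cat ?size_map ?(size_decomp d1) // IH1 IH2.
Qed.

(** The descent towards a gap free of top keys leaves the top part into the hanging subtree whose
    index is the number of keys not above [lo]. The shape of the top part does not enter, so the cut
    is the same before and after a restructuring. *)
Lemma cut_decomp lo hi t ks ss : decomp t ks ss -> is_bst t ->
    {in unzip1 ks, forall y, ~~ in_open lo hi y} ->
  cut lo hi t =
  cut lo hi (nth Leaf ss (count (fun y => ~~ in_open lo None y) (unzip1 ks))).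
Proof.
elim=> // a k p b ks1 ks2 ss1 ss2 d1 IH1 d2 IH2 _ bt kso.
have [ba bb ak bk] := bst_node bt.
have kNo : ~~ in_open lo hi k by apply: kso; rewrite /unzip1 map_cat mem_cat inE eqxx orbT.
rewrite /= (negPf kNo) /unzip1 map_cat count_cat /= nth_cat (size_decomp d1).
case: ifP => klo.
- have -> : count (fun y => ~~ in_open lo None y) (unzip1 ks2) = 0.
    apply/eqP; rewrite -leqn0 leqNgt -has_count; apply/hasPn => y yk.
    by have := bk _ (decomp_sub d2 yk); move: klo; rewrite /in_open; case: (lo) => [z|] /=; lia.
  rewrite !addn0 ltnS -(size_map fst) count_size; apply: IH1 => // y yk.
  by apply: kso; rewrite /unzip1 map_cat mem_cat yk.
- have -> : count (fun y => ~~ in_open lo None y) (unzip1 ks1) = size ks1.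
    rewrite -(size_map fst); apply/eqP; rewrite -all_count; apply/allP => y yk.
    by have := ak _ (decomp_sub d1 yk); move: klo; rewrite /in_open; case: (lo) => [z|] /=; lia.
  set c := count _ _.
  have -> : (size ks1 + (true + c) < (size ks1).+1) = false by lia.
  have -> : size ks1 + (true + c) - (size ks1).+1 = c by lia.
  apply: IH2 => // y yk.
  by apply: kso; rewrite /unzip1 map_cat mem_cat inE yk !orbT.
Qed.

Lemma mem_unzip1 (ks : seq (nat * A)) e : e \in ks -> e.1 \in unzip1 ks.
Proof. exact: map_f. Qed.

(** Heap order keeps gap keys from lying above an endpoint that strictly precedes all of them, so
    the descent passes that endpoint first. The first alternative of each hypothesis covers an
    endpoint that is infinite or already passed, as the induction requires. *)
Lemma iso_decomp lo hi t ks ss : decomp t ks ss -> is_bst t ->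
    {in inorder t, forall y, in_open lo None y} \/
    (exists e, [/\ e \in ks, lo = Some e.1 &
      {in ks, forall e', in_open lo hi e'.1 -> R e.2 e'.2}]) ->
    {in inorder t, forall y, in_open None hi y} \/
    (exists e, [/\ e \in ks, hi = Some e.1 &
      {in ks, forall e', in_open lo hi e'.1 -> R e.2 e'.2}]) ->
  iso lo hi t.
Proof.
elim=> [s _|a k p b ks1 ks2 ss1 ss2 d1 IH1 d2 IH2 heap bt] Hlo Hhi.
  case: Hlo => [Hlo|[e []//]]; case: Hhi => [Hhi|[e []//]].
  by move=> y /(@cut_sub _ _ _ _) ys; rewrite in_openE Hlo ?Hhi.
have [ba bb ak bk] := bst_node bt.
have ks1k e : e \in ks1 -> e.1 < k.
  by move=> /mem_unzip1 /(decomp_sub d1) /ak.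
have ks2k e : e \in ks2 -> k < e.1.
  by move=> /mem_unzip1 /(decomp_sub d2) /bk.
have kin : (k, p) \in ks1 ++ (k, p) :: ks2 by rewrite mem_cat inE eqxx orbT.
have kt : k \in inorder (Node a k b) by rewrite mem_node eqxx.
have at_ y : y \in inorder a -> y \in inorder (Node a k b).
  by rewrite mem_node => ->; rewrite orbT.
have bt_ y : y \in inorder b -> y \in inorder (Node a k b).
  by rewrite mem_node => ->; rewrite !orbT.
have in1 e : e \in ks1 -> e \in ks1 ++ (k, p) :: ks2 by rewrite mem_cat => ->.
have in2 e : e \in ks2 -> e \in ks1 ++ (k, p) :: ks2.
  by rewrite mem_cat inE => ->; rewrite !orbT.
rewrite /iso cutE; case: ifP => kO.
  (* An endpoint among the remaining keys would strictly precede this root, against heap order;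
     hence both endpoints have been passed. *)
  case: Hlo => [Hlo|[e [ein _ /(_ _ kin kO) lt]]]; last by have := heap _ ein; rewrite lt.
  case: Hhi => [Hhi|[e [ein _ /(_ _ kin kO) lt]]]; last by have := heap _ ein; rewrite lt.
  by move=> y yt; rewrite in_openE Hlo ?Hhi.
case: ifP => klo.
- apply: IH1 => //.
    case: Hlo => [Hlo|[e [ein elo H]]]; [by left=> y /at_/Hlo | right].
    exists e; split => // [|e' /in1]; last exact: H.
    move: ein; rewrite mem_cat inE => /or3P[//|/eqP ee|/ks2k]; subst lo.
      by move: klo; rewrite ee /in_open /=; lia.
    by move: klo; rewrite /in_open /=; lia.
  case: Hhi => [Hhi|[e [ein ehi H]]]; first by left=> y /at_/Hhi.
  move: ein; rewrite mem_cat inE => /or3P[e1|/eqP ee|/ks2k]; last 1 first.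
  + by move: klo kO; subst hi; rewrite /in_open; case: (lo) => [z|] /=; lia.
  + by right; exists e; split => // e' /in1; apply: H.
  + by left=> y /ak; subst hi; rewrite ee.
(* Here [k] is at or below [lo]; if it is also at or above [hi], the gap is empty. *)
- have [em|ne] : (forall y, ~~ in_open lo hi y) \/ in_open None hi k.
    move: kO; rewrite in_openE klo; case: (boolP (in_open None hi k)) => kh _; first by right.
    by left=> y; open_lia lo hi.
  + by rewrite cut_leaf.
  apply: IH2 => //; last first.
    case: Hhi => [Hhi|[e [ein ehi H]]]; [by left=> y /bt_/Hhi | right].
    exists e; split => // [|e' /in2]; last exact: H.
    by move: ein; rewrite mem_cat inE => /or3P[/ks1k|/eqP ee|//]; subst hi;
      move: ne; rewrite ?ee /in_open /=; lia.
  case: Hlo => [/(_ _ kt)|[e [ein elo H]]]; first by rewrite klo.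
  move: ein; rewrite mem_cat inE => /or3P[/ks1k|/eqP ee|e2].
  + by move: klo; subst lo; rewrite /in_open /=; lia.
  + by left=> y /bk; subst lo; rewrite ee /in_open /= andbT.
  + by right; exists e; split => // e' /in2; apply: H.
Qed.

End Decomp.

(** * Search paths *)

(** The empty relation drops the heap condition: before a step, the search path need not be
    heap-ordered. *)
Lemma path_decomp x t d :
  decomp (fun _ _ : nat => false) t (path_split x t d).1 (path_split x t d).2.
Proof.
elim: t d => [|l IHl k r IHr] d /=; first exact: DLeaf.
case: ifP => _ /=; first exact: (DNode (DLeaf _ _) (DLeaf _ _)).
case: ifP => _ /=; last exact: (DNode (DLeaf _ _) (IHr _)).
by rewrite -!cats1; apply: DNode => //; apply: DLeaf.
Qed.

Definition path_keys x t := unzip1 (path_split x t 0).1.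

Lemma path_keysE x l k r : path_keys x (Node l k r) =
  if x == k then [:: k]
  else if x < k then rcons (path_keys x l) k else k :: path_keys x r.
Proof.
have depth_irrel t d : unzip1 (path_split x t d).1 = path_keys x t.
  rewrite /path_keys; elim: t d 0 => [|l' IHl k' r' IHr] d d' //=.
  case: ifP => //= _; case: ifP => _ /=; last by rewrite (IHr _ d'.+1).
  by rewrite /unzip1 !map_rcons -!/(unzip1 _) (IHl _ d'.+1).
rewrite {1}/path_keys /=; case: ifP => //= _; case: ifP => _ /=.
  by rewrite /unzip1 map_rcons -/(unzip1 _) depth_irrel.
by rewrite depth_irrel.
Qed.

Lemma path_keys_sub x t : {subset path_keys x t <= inorder t}.
Proof. exact: decomp_sub (path_decomp x t 0). Qed.

Lemma mem_path_root x l k r : k \in path_keys x (Node l k r).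
Proof.
rewrite path_keysE; case: ifP => _; first by rewrite inE.
by case: ifP; rewrite ?mem_rcons inE eqxx.
Qed.

Lemma mem_path x t : is_bst t -> x \in inorder t -> x \in path_keys x t.
Proof.
elim: t => [|l IHl k r IHr] // /bst_node[bl br lk rk].
rewrite mem_node path_keysE; case: ltngtP => [xk|kx|->] //=; last by rewrite inE eqxx.
  case/orP=> [xl|/rk]; last by rewrite ltnNge ltnW.
  by rewrite mem_rcons inE IHl ?orbT.
case/orP=> [/lk|xr]; first by rewrite ltnNge ltnW.
by rewrite inE IHr ?orbT.
Qed.

Lemma path_below x l k r : is_bst (Node l k r) -> x < k ->
  {in path_keys x (Node l k r), forall y, y <= k}.
Proof.
move=> /bst_node[_ _ lk _] xk y; rewrite path_keysE ltn_eqF // xk mem_rcons inE.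
by case/orP=> [/eqP->//|/path_keys_sub/lk/ltnW].
Qed.

Lemma path_above x l k r : is_bst (Node l k r) -> k < x ->
  {in path_keys x (Node l k r), forall y, k <= y}.
Proof.
move=> /bst_node[_ _ _ rk] kx y; rewrite path_keysE gtn_eqF // ltnNge ltnW // inE.
by case/orP=> [/eqP->//|/path_keys_sub/rk/ltnW].
Qed.

(** All gap keys sit in the cut, and an isolated cut does not contain [x], so the search never
    enters it. *)
Lemma path_avoid x t lo hi : is_bst t -> x \in inorder t -> ~~ in_open lo hi x ->
  iso lo hi t -> {in path_keys x t, forall y, ~~ in_open lo hi y}.
Proof.
elim: t => [|l IHl k r IHr] // bt xt xo.
have [bl br lk rk] := bst_node bt.
rewrite /iso cutE; case: ifP => [_ /(_ _ xt)|kO isoc y]; first by rewrite (negPf xo).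
move: xt; rewrite mem_node path_keysE.
case: (ltngtP x k) => [xk|kx|_] /=; last by rewrite inE => _ /eqP ->; rewrite kO.
  case/orP=> [xl|/rk]; last by rewrite ltnNge ltnW.
  rewrite mem_rcons inE => /orP[/eqP->|yp]; first by rewrite kO.
  move: isoc; case: ifP => klo isoc; first exact: IHl isoc _ yp.
  by have := lk _ (path_keys_sub yp); clear -klo; open_lia lo hi.
case/orP=> [/lk|xr]; first by rewrite ltnNge ltnW.
rewrite inE => /orP[/eqP->|yp]; first by rewrite kO.
move: isoc; case: ifP => klo isoc; last exact: IHr isoc _ yp.
by have := rk _ (path_keys_sub yp); clear -klo kO; open_lia lo hi.
Qed.

(** * The treap built by one step *)

Lemma lt_prio_irr p : lt_prio p p = false.
Proof. by case: p => [[a|] b]; rewrite /lt_prio /=; lia. Qed.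

Lemma lt_prio_trans : transitive lt_prio.
Proof. move=> [[c|] d] [[a|] b] [[e|] f]; rewrite /lt_prio /=; lia. Qed.

(** [find] returns the length if nothing matches; a minimal label exists because the order is
    irreflexive and transitive. *)
Lemma argmin_lt ks : ks != [::] -> argmin ks < size ks.
Proof.
move=> ks0; rewrite /argmin -has_find; apply/hasP.
elim: ks ks0 => [//|e ks IH] _.
have [->|/IH[m mks mmin]] := eqVneq ks [::].
  by exists e; rewrite ?inE ?eqxx //= lt_prio_irr.
case: (boolP (lt_prio e.2 m.2)) => em.
  exists e; rewrite ?inE ?eqxx //= lt_prio_irr /=; apply/allP => e' e'ks.
  by apply: contra (allP mmin _ e'ks) => /lt_prio_trans; apply.
by exists m; rewrite ?inE ?mks ?orbT //= em.
Qed.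

Lemma buildE fuel ks ss : ks != [::] -> build fuel.+1 ks ss =
  Node (build fuel (take (argmin ks) ks) (take (argmin ks).+1 ss))
       (nth 0 (unzip1 ks) (argmin ks))
       (build fuel (drop (argmin ks).+1 ks) (drop (argmin ks).+1 ss)).
Proof. by case: ks. Qed.

(** Each root chosen has a minimal label, which is the heap condition; the fuel always exceeds the
    number of keys left, so it never runs out. *)
Lemma build_decomp fuel ks ss : size ks < fuel -> size ss = (size ks).+1 ->
  decomp lt_prio (build fuel ks ss) ks ss.
Proof.
elim: fuel ks ss => [|fuel IH] ks ss // szf szs.
have [E|ks0] := eqVneq ks [::].
  by rewrite E in szs *; case: ss szs => [|s []] //= _; apply: DLeaf.
rewrite buildE //; have := argmin_lt ks0; set j := argmin ks => jlt.
have e : nat * prio by case: (ks) ks0.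
have ej : nth e ks j = (nth 0 (unzip1 ks) j, (nth e ks j).2).
  by rewrite (nth_map e) //; case: nth.
have szj : size (take j ks) = j by rewrite size_takel // ltnW.
have dec1 : size (take j ks) < fuel by rewrite szj -ltnS (leq_trans _ szf).
have dec2 : size (take j.+1 ss) = (size (take j ks)).+1.
  by rewrite szj size_takel // szs ltnW.
have dec3 : size (drop j.+1 ks) < fuel.
  by rewrite size_drop ltn_subLR // addSn ltnS (@leq_trans fuel) // leq_addl.
have dec4 : size (drop j.+1 ss) = (size (drop j.+1 ks)).+1.
  by rewrite !size_drop szs subSn.
suff : decomp lt_prio
    (Node (build fuel (take j ks) (take j.+1 ss)) (nth 0 (unzip1 ks) j)
       (build fuel (drop j.+1 ks) (drop j.+1 ss)))
    (take j ks ++ (nth 0 (unzip1 ks) j, (nth e ks j).2) :: drop j.+1 ks)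
    (take j.+1 ss ++ drop j.+1 ss).
  by rewrite -ej -drop_nth // !cat_take_drop.
apply: DNode.
- exact: IH.
- exact: IH.
- rewrite -ej -drop_nth // cat_take_drop; apply/allP.
  by apply: (@nth_find _ e (fun e => all (fun e' => ~~ lt_prio e'.2 e.2) ks));
    rewrite has_find.
Qed.

Definition prios X m t : seq (nat * prio) :=
  let vs := (path_split (nth 0 X m) t 0).1 in
  let key i := (nth (0, 0) vs i).1 in
  mkseq (fun i =>
    (key i,
     (next_time X m (if i == 0 then None else Some (key i.-1))
                    (if i.+1 == size vs then None else Some (key i.+1)),
      (nth (0, 0) vs i).2))) (size vs).

Lemma gf_stepE X m t : gf_step X m t =
  build (size (path_split (nth 0 X m) t 0).1).+1 (prios X m t)
        (path_split (nth 0 X m) t 0).2.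
Proof. by []. Qed.

Lemma prios_keys X m t : unzip1 (prios X m t) = path_keys (nth 0 X m) t.
Proof.
rewrite /prios /path_keys /unzip1 /mkseq -map_comp /comp /=.
set vs := (path_split _ _ _).1.
by rewrite -[in RHS](mkseq_nth (0, 0) vs) /mkseq -map_comp.
Qed.

Lemma gf_decomp X m t :
  decomp lt_prio (gf_step X m t) (prios X m t) (path_split (nth 0 X m) t 0).2.
Proof.
rewrite gf_stepE; apply: build_decomp; first by rewrite /prios size_mkseq.
by rewrite (size_decomp (path_decomp _ _ _)) /prios size_mkseq.
Qed.

Lemma inorder_gf_step X m t : inorder (gf_step X m t) = inorder t.
Proof.
rewrite (inorder_decomp (gf_decomp X m t)) prios_keys.
by rewrite (inorder_decomp (path_decomp (nth 0 X m) t 0)).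
Qed.

Lemma bst_gf_step X m t : is_bst (gf_step X m t) = is_bst t.
Proof. by rewrite /is_bst inorder_gf_step. Qed.

Lemma cut_gf_step X m t lo hi : is_bst t ->
    {in path_keys (nth 0 X m) t, forall y, ~~ in_open lo hi y} ->
  cut lo hi (gf_step X m t) = cut lo hi t.
Proof.
move=> bt Ko; rewrite (cut_decomp (gf_decomp X m t)) ?bst_gf_step ?prios_keys //.
by rewrite (cut_decomp (path_decomp (nth 0 X m) t 0)).
Qed.

(** * Effect of one step on gaps and on the root *)

(** A two-valued view of next access times. Every priority comparison below is between a key
    accessed before time [N] and one that is not, so neither exact times nor depths matter. *)
Definition soon N (o : option nat) := if o is Some s then s < N else false.

Lemma lt_prio_soon N p q : soon N p.1 -> ~~ soon N q.1 -> lt_prio p q.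
Proof. by case: p q => [[a|] b] [[c|] d]; rewrite /soon /lt_prio /=; lia. Qed.

Lemma soon_next_time X m F1 F2 lo hi : drop m.+1 X = F1 ++ F2 ->
  soon (m.+1 + size F1) (next_time X m lo hi) = has (in_open lo hi) F1.
Proof.
move=> dX; rewrite /next_time dX find_cat size_cat.
have := has_find (in_open lo hi) F1; case: has => /esym F1lt.
  by rewrite ltn_addr //= ltn_add2l F1lt.
by case: ifP => //= _; lia.
Qed.

Lemma sorted_path_keys x t : is_bst t -> sorted ltn (path_keys x t).
Proof.
by move=> bt; apply: (subseq_sorted ltn_trans (subseq_decomp (path_decomp x t 0))).
Qed.

(** Describes the interval between the path neighbours of [e.1] without indices: it consists of the
    points on the same side as [e.1] of every other path key. *)
Lemma priosP X m t e : is_bst t -> e \in prios X m t ->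
  exists lo hi, [/\ e.2.1 = next_time X m lo hi,
    forall y, {in path_keys (nth 0 X m) t, forall v,
       (v < e.1 -> v < y) /\ (e.1 < v -> y < v)} -> in_open lo hi y
  & forall y, in_open lo hi y -> {in path_keys (nth 0 X m) t, forall v,
       (v < e.1 -> v < y) /\ (e.1 < v -> y < v)}].
Proof.
move=> /(sorted_path_keys (nth 0 X m)) sK.
case/mapP => i; rewrite mem_iota add0n /= => ilt ->.
set vs := (path_split _ _ _).1 in ilt *.
have szK : size (path_keys (nth 0 X m) t) = size vs by rewrite size_map.
have keyE j : j < size vs -> (nth (0, 0) vs j).1 = nth 0 (path_keys (nth 0 X m) t) j.
  by move=> jlt; rewrite (nth_map (0, 0)).
have Klt a b : a < b -> b < size vs ->
    (nth (0, 0) vs a).1 < (nth (0, 0) vs b).1.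
  move=> ab blt; rewrite !keyE ?(ltn_trans ab) //.
  apply: (sorted_ltn_nth ltn_trans 0 sK) => //; rewrite inE szK //.
  exact: ltn_trans blt.
have Kle a b : a <= b -> b < size vs ->
    (nth (0, 0) vs a).1 <= (nth (0, 0) vs b).1.
  by rewrite leq_eqVlt => /orP[/eqP->//|ab /(Klt _ _ ab)/ltnW].
have Kin a : a < size vs -> (nth (0, 0) vs a).1 \in path_keys (nth 0 X m) t.
  by move=> alt; rewrite keyE // mem_nth ?szK.
set lo := if _ then _ else _; set hi := if _ then _ else _.
exists lo, hi; split=> [//|y Hy|y yo v /(nthP 0)[j]].
  rewrite in_openE /lo /hi /in_open andbT /=.
  apply/andP; split.
    case: eqP => // i0; have ilt' : i.-1 < size vs by lia.
    by apply: (Hy _ (Kin _ ilt')).1; apply: Klt; lia.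
  case: eqP => // i0; have ilt' : i.+1 < size vs by lia.
  by apply: (Hy _ (Kin _ ilt')).2; apply: Klt; lia.
rewrite szK => jlt <-; rewrite -keyE //=.
move: yo; rewrite in_openE /in_open /lo /hi andbT /= => /andP[ylo yhi]; split=> lt.
  have ji : j < i by rewrite ltnNge; apply/negP => /Kle /(_ jlt); lia.
  move: ylo; case: eqP => [|_ ylo]; first lia.
  by apply: leq_ltn_trans ylo; apply: Kle; lia.
have ji : i < j by rewrite ltnNge; apply/negP => /Kle /(_ ilt); lia.
move: yhi; case: eqP => [|_ yhi]; first lia.
by apply: leq_trans yhi _; apply: Kle; lia.
Qed.

(* The witness y for lo is a query that raises the priority of lo: it lies in the
   open interval between the path neighbours of lo. *)
Lemma iso_gf_step X m t lo hi F1 F2 :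
    is_bst t -> drop m.+1 X = F1 ++ F2 ->
    {in F1, forall y, ~~ in_open lo hi y} ->
    lo = None \/ (exists l y, [/\ lo = Some l, l \in path_keys (nth 0 X m) t,
      y \in F1, y <= l & {in path_keys (nth 0 X m) t, forall v, v < l -> v < y}]) ->
    hi = None \/ (exists h y, [/\ hi = Some h, h \in path_keys (nth 0 X m) t,
      y \in F1, h <= y & {in path_keys (nth 0 X m) t, forall v, h < v -> y < v}]) ->
  iso lo hi (gf_step X m t).
Proof.
move=> bt dX F1o Hlo Hhi.
have loK l : lo = Some l -> l \in path_keys (nth 0 X m) t.
  by move=> E; case: Hlo => [|[l' [y []]]]; rewrite E // => -[->].
have hiK h : hi = Some h -> h \in path_keys (nth 0 X m) t.
  by move=> E; case: Hhi => [|[h' [y []]]]; rewrite E // => -[->].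
(* The finite endpoints are path keys, so the interval of a gap key stays inside the gap, where [F1]
   has no query. *)
have late e : e \in prios X m t -> in_open lo hi e.1 ->
    ~~ soon (m.+1 + size F1) e.2.1.
  move=> /(priosP bt)[a [b [-> _ ab]]] eo; rewrite (soon_next_time _ _ dX).
  apply/hasPn => y yF; apply: contra (F1o _ yF) => /ab Hy.
  move: eo; rewrite /in_open => /andP[lt1 lt2]; apply/andP; split.
    by case: (lo) loK lt1 => // l /(_ _ erefl) /Hy[+ _]; apply.
  by case: (hi) hiK lt2 => // h /(_ _ erefl) /Hy[_]; apply.
(* A key whose interval receives a query of [F1] therefore precedes every gap key. *)
have early k y : k \in path_keys (nth 0 X m) t -> y \in F1 ->
    {in path_keys (nth 0 X m) t, forall v, (v < k -> v < y) /\ (k < v -> y < v)} ->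
    exists e, [/\ e \in prios X m t, e.1 = k &
      {in prios X m t, forall e', in_open lo hi e'.1 -> lt_prio e.2 e'.2}].
  rewrite -prios_keys => /mapP[e ein ->] yF Hy; exists e; split => // e' e'in e'o.
  apply: (@lt_prio_soon (m.+1 + size F1)); last exact: late.
  have [a [b [-> ab _]]] := priosP bt ein; rewrite (soon_next_time _ _ dX).
  by apply/hasP; exists y => //; apply: ab; rewrite -prios_keys.
apply: (iso_decomp (gf_decomp X m t)); rewrite ?bst_gf_step //.
  case: Hlo => [->|[l [y [loE lK yF yl Hl]]]]; first by left.
  right; have [v vK|e [ein eE He]] := early _ _ lK yF; last first.
    by exists e; rewrite loE eE -loE.
  by split=> [/(Hl _ vK)|/(leq_ltn_trans yl)].
case: Hhi => [->|[h [y [hiE hK yF hy Hh]]]]; first by left.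
right; have [v vK|e [ein eE He]] := early _ _ hK yF; last first.
  by exists e; rewrite hiE eE -hiE.
by split=> [/leq_trans|/(Hh _ vK)] //; apply.
Qed.

Lemma root_decomp (A : eqType) (R : rel A) t ks ss e : decomp R t ks ss ->
  e \in ks -> {in ks, forall e', e'.1 != e.1 -> R e.2 e'.2} ->
  exists a b, t = Node a e.1 b.
Proof.
case=> // a k p b ks1 ks2 ss1 ss2 _ _ heap ein Re.
have kin : (k, p) \in ks1 ++ (k, p) :: ks2 by rewrite mem_cat inE eqxx orbT.
have [<-|ke] := eqVneq k e.1; first by exists a, b.
by have := heap _ ein; rewrite (Re _ kin ke).
Qed.

(** Among the path keys only [k] is accessed by the very next query: [y] is outside the interval of
    any other path key, being either [k] itself or at or beyond the last path key [k]. *)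
Lemma root_gf_step X m t k y Z : is_bst t -> drop m.+1 X = y :: Z ->
    k \in path_keys (nth 0 X m) t ->
    y = k \/ k <= y /\ {in path_keys (nth 0 X m) t, forall v, v <= k} ->
  exists a b, gf_step X m t = Node a k b.
Proof.
move=> bt dX kK Hy; have dX' : drop m.+1 X = [:: y] ++ Z by [].
have := kK; rewrite -prios_keys => /mapP[e ein ek].
rewrite {1}ek; apply: (root_decomp (gf_decomp X m t) ein) => e' e'in ee'.
apply: (@lt_prio_soon (m.+1 + size [:: y])).
  have [a [b [-> ab _]]] := priosP bt ein.
  rewrite (soon_next_time _ _ dX') /= orbF; apply: ab => v vK; rewrite -ek.
  case: Hy => [->//|[ky Kk]]; have := Kk _ vK; split; lia.
have [a [b [-> _ ab]]] := priosP bt e'in.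
rewrite (soon_next_time _ _ dX') /= orbF; apply/negP => /ab.
have e'K : e'.1 \in path_keys (nth 0 X m) t by rewrite -prios_keys map_f.
move=> /(_ _ kK); move: ee'; rewrite -ek.
case: Hy => [->|[ky /(_ _ e'K)]]; lia.
Qed.

Lemma cut_root a k b : is_bst (Node a k b) ->
  cut None (Some k) (Node a k b) = a /\ cut (Some k) None (Node a k b) = b.
Proof.
move=> /bst_node[_ _ ak bk]; rewrite !cutE /in_open !ltnn /=.
by split; apply: cut_id => y; [move=> /ak|move=> /bk]; rewrite /in_open ?andbT.
Qed.

Lemma iso_root a k b : is_bst (Node a k b) ->
  iso None (Some k) (Node a k b) /\ iso (Some k) None (Node a k b).
Proof.
move=> bt; have [_ _ ak bk] := bst_node bt; have [ea eb] := cut_root bt.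
by split=> y; rewrite (ea, eb); [move=> /ak|move=> /bk]; rewrite /in_open ?andbT.
Qed.

Lemma gf_step_root X m a k b : is_bst (Node a k b) -> nth 0 X m = k ->
  gf_step X m (Node a k b) = Node a k b.
Proof.
move=> bt Xm; have [ea eb] := cut_root bt; have [ia ib] := iso_root bt.
have pk : path_keys (nth 0 X m) (Node a k b) = [:: k].
  by rewrite path_keysE Xm eqxx.
have c1 : cut None (Some k) (gf_step X m (Node a k b)) = a.
  by rewrite cut_gf_step // pk => y; rewrite inE => /eqP ->; rewrite /in_open ltnn.
have c2 : cut (Some k) None (gf_step X m (Node a k b)) = b.
  by rewrite cut_gf_step // pk => y; rewrite inE => /eqP ->; rewrite /in_open ltnn.
rewrite (@glue None None k (gf_step X m (Node a k b))) ?c1 ?c2 //.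
- by rewrite bst_gf_step.
- by rewrite inorder_gf_step mem_node eqxx.
- by rewrite /iso c1 -{1}ea.
- by rewrite /iso c2 -{1}eb.
Qed.

(** * Persistence of isolated gaps over several queries *)

Lemma gf_runS X T0 m : gf_run X T0 m.+1 = gf_step X m (gf_run X T0 m).
Proof. by []. Qed.

Lemma bst_gf_run X T0 m : is_bst (gf_run X T0 m) = is_bst T0.
Proof. by elim: m => //= m <-; rewrite bst_gf_step. Qed.

Lemma inorder_gf_run X T0 m : inorder (gf_run X T0 m) = inorder T0.
Proof. by elim: m => //= m <-; rewrite inorder_gf_step. Qed.

Lemma drop_cons (X : seq nat) m x Z : drop m X = x :: Z ->
  nth 0 X m = x /\ drop m.+1 X = Z.
Proof.
move=> dX; split; first by rewrite -[m]addn0 -nth_drop dX.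
by rewrite -add1n -drop_drop dX /= drop0.
Qed.

Lemma cut_gf_run X T0 lo hi m Q Z : is_bst T0 -> {subset X <= inorder T0} ->
    drop m X = Q ++ Z -> iso lo hi (gf_run X T0 m) ->
    {in Q, forall y, ~~ in_open lo hi y} ->
  cut lo hi (gf_run X T0 (m + size Q)) = cut lo hi (gf_run X T0 m).
Proof.
move=> b0 X0; elim: Q m => [|q Q IH] m; first by rewrite addn0.
move=> /= dX isom Qo; have [qE dX'] := drop_cons dX.
have step : cut lo hi (gf_run X T0 m.+1) = cut lo hi (gf_run X T0 m).
  rewrite /= cut_gf_step ?bst_gf_run //; apply: path_avoid; rewrite ?bst_gf_run //.
    by rewrite inorder_gf_run qE; apply: X0; apply: (@mem_drop m); rewrite dX inE eqxx.
  by rewrite qE Qo ?inE ?eqxx.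
rewrite addnS -addSn IH //; first by rewrite /iso step.
by move=> y yQ; rewrite Qo // inE yQ orbT.
Qed.

Lemma iso_gf_run X T0 lo hi m Q Z : is_bst T0 -> {subset X <= inorder T0} ->
    drop m X = Q ++ Z -> iso lo hi (gf_run X T0 m) ->
    {in Q, forall y, ~~ in_open lo hi y} ->
  iso lo hi (gf_run X T0 (m + size Q)).
Proof. by move=> b0 X0 dX isom Qo; rewrite /iso (cut_gf_run b0 X0 dX). Qed.


(** * The query script and its correctness *)

(* After the query of hi, the next query of lo keeps k above the right subtree;
   with a single ancestor available, k itself has to be queried once more. *)
Definition closing (lo hi : option nat) (k : nat) : seq nat :=
  match lo, hi with
  | Some l, Some h => [:: k; k; l; h]
  | Some l, None => [:: k; k; l; k]
  | None, Some h => [:: k; k; h; k]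
  | None, None => [:: k; k]
  end.

Fixpoint script (lo hi : option nat) (t : tree) : seq nat :=
  if t is Node l k r then
    script lo (Some k) l ++ script (Some k) hi r ++
    (if nilp (inorder l ++ inorder r) then [::] else closing lo hi k)
  else [::].

(** [F1] stands for later queries of the script. They return to the finite endpoints without
    entering the gap, and this gives the endpoints priority over all gap keys. *)
Lemma closing_iso X T0 lo hi k m F1 F2 :
    is_bst T0 -> {subset X <= inorder T0} -> in_open lo hi k ->
    drop m X = closing lo hi k ++ F1 ++ F2 ->
    {in F1, forall y, ~~ in_open lo hi y} ->
    (forall l, lo = Some l -> l \in F1) -> (forall h, hi = Some h -> h \in F1) ->
  iso lo (Some k) (gf_run X T0 (m + size (closing lo hi k))) /\
  iso (Some k) hi (gf_run X T0 (m + size (closing lo hi k))).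
Proof.
move=> b0 X0 ko dX F1o loF hiF.
have bs i : is_bst (gf_run X T0 i) by rewrite bst_gf_run.
have inP i x Z : drop i X = x :: Z -> x \in path_keys (nth 0 X i) (gf_run X T0 i).
  move=> dXi; have [-> _] := drop_cons dXi; apply: mem_path => //.
  by rewrite inorder_gf_run; apply: X0; apply: (@mem_drop i); rewrite dXi inE eqxx.
have [Z dXZ] : exists Z, drop m X = [:: k, k & Z].
  by rewrite dX; case: (lo); case: (hi) => * /=; eexists.
have [nm dX1] := drop_cons dXZ; have [nm1 dX2] := drop_cons dX1.
(* The first query of [k] is followed by another, so [k] becomes the root; the second meets a
   one-key path and changes nothing. *)
have [a [b root1]] : exists a b, gf_run X T0 m.+1 = Node a k b.
  by apply: (root_gf_step (bs m) dX1 (inP _ _ _ dXZ)); left.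
have root2 : gf_run X T0 m.+2 = Node a k b.
  by rewrite gf_runS root1 gf_step_root // -root1.
have bt := bs m.+2; rewrite root2 in bt.
have [ia ib] := iso_root bt; rewrite -root2 in ia ib.
have kP x : k \in path_keys x (gf_run X T0 m.+2) by rewrite root2 mem_path_root.
have isoS i u v F1' F2' : drop i.+1 X = F1' ++ F2' ->
    {in F1', forall y, ~~ in_open u v y} -> _ -> _ -> iso u v (gf_run X T0 i.+1) :=
  fun e => @iso_gf_step X i _ u v F1' F2' (bs i) e.
have E2 : m + 2 = m.+2 by rewrite addn2.
have dXr : drop m.+2 X = drop 2 (closing lo hi k) ++ F1 ++ F2.
  by rewrite -E2 addnC -drop_drop dX; case: (lo); case: (hi) => * /=; rewrite ?drop0.
case: lo hi ko F1o loF hiF dXr {dX} => [l|] [h|] /= ko F1o loF hiF dXr; rewrite /in_open /= ?andbT in ko.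
- have [lk kh] := andP ko.
  have [n2 dX3] := drop_cons dXr; have [n3 dX4] := drop_cons dX3.
  have dX3' : drop m.+3 X = (h :: F1) ++ F2 by [].
  (* The path to [l] has [k] as its last key, so the coming query of [h] falls into the interval of
     [k] and keeps [k] at the root. *)
  have [a' [b' root3]] : exists a b, gf_run X T0 m.+3 = Node a k b.
    apply: (root_gf_step (bs _) dX3 (kP _)); right; split; first exact: ltnW.
    by rewrite n2 root2; apply: path_below.
  (* The witness for [l] is its later query in [F1], and the witness for [k] is [h]. *)
  have i3 : iso (Some l) (Some k) (gf_run X T0 m.+3).
    apply: (isoS _ _ _ _ _ dX3').
    + move=> y; rewrite inE => /orP[/eqP->|/F1o]; rewrite /in_open; lia.
    + by right; exists l, l; split => //; [exact: inP dXr|rewrite inE loF ?orbT].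
    + right; exists k, h; split => //; [by rewrite inE eqxx|exact: ltnW|].
      by rewrite n2 root2 => v /(path_below bt lk); lia.
  have i4 : iso (Some l) (Some k) (gf_run X T0 (m.+3 + size [:: h])).
    apply: (iso_gf_run b0 X0 (Q := [:: h]) dX3 i3) => y.
    by rewrite inE => /eqP->; rewrite /in_open; lia.
  rewrite addn4; rewrite addn1 in i4; split => //.
  apply: (isoS _ _ _ _ _ dX4).
  + by move=> y /F1o; rewrite /in_open; lia.
  + right; exists k, l; split => //; [|exact: loF|exact: ltnW|].
      by rewrite root3 mem_path_root.
    rewrite n3 root3 => v vP; have := bs m.+3; rewrite root3 => bt3.
    by have := path_above bt3 kh vP; lia.
  + by right; exists h, h; split => //; [exact: inP dX3|exact: hiF].
- have [n2 dX3] := drop_cons dXr; have [n3 dX4] := drop_cons dX3.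
  have dX3' : drop m.+3 X = (k :: F1) ++ F2 by [].
  have i3 : iso (Some l) (Some k) (gf_run X T0 m.+3).
    apply: (isoS _ _ _ _ _ dX3').
    + move=> y; rewrite inE => /orP[/eqP->|/F1o]; rewrite /in_open; lia.
    + by right; exists l, l; split => //; [exact: inP dXr|rewrite inE loF ?orbT].
    + by right; exists k, k; split => //; rewrite inE eqxx.
  have i4 : iso (Some l) (Some k) (gf_run X T0 (m.+3 + size [:: k])).
    apply: (iso_gf_run b0 X0 (Q := [:: k]) dX3 i3) => y.
    by rewrite inE => /eqP->; rewrite /in_open; lia.
  rewrite addn4; rewrite addn1 in i4; split => //.
  (* The gap above [k] was isolated as soon as [k] was the root, and neither remaining query lies in
     it. *)
  have -> : m.+4 = m.+2 + size [:: l; k] by rewrite addn2.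
  apply: (iso_gf_run b0 X0 (Q := [:: l; k]) dXr ib) => y.
  by rewrite !inE => /orP[] /eqP->; rewrite /in_open; lia.
- have [n2 dX3] := drop_cons dXr; have [n3 dX4] := drop_cons dX3.
  have dX3' : drop m.+3 X = (k :: F1) ++ F2 by [].
  have i3 : iso (Some k) (Some h) (gf_run X T0 m.+3).
    apply: (isoS _ _ _ _ _ dX3').
    + move=> y; rewrite inE => /orP[/eqP->|/F1o]; rewrite /in_open; lia.
    + by right; exists k, k; split => //; rewrite inE eqxx.
    + by right; exists h, h; split => //; [exact: inP dXr|rewrite inE hiF ?orbT].
  have i4 : iso (Some k) (Some h) (gf_run X T0 (m.+3 + size [:: k])).
    apply: (iso_gf_run b0 X0 (Q := [:: k]) dX3 i3) => y.
    by rewrite inE => /eqP->; rewrite /in_open; lia.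
  rewrite addn4; rewrite addn1 in i4; split => //.
  have -> : m.+4 = m.+2 + size [:: h; k] by rewrite addn2.
  apply: (iso_gf_run b0 X0 (Q := [:: h; k]) dXr ia) => y.
  by rewrite !inE => /orP[] /eqP->; rewrite /in_open; lia.
- by rewrite addn2.
Qed.

Lemma closing_sub lo hi k y : y \in closing lo hi k ->
  [|| y == k, lo == Some y | hi == Some y].
Proof.
case: lo hi => [l|] [h|]; rewrite !inE; do ?[case/orP]; move/eqP->;
  by rewrite eqxx ?orbT.
Qed.

Lemma script_sub lo hi t y : y \in script lo hi t ->
  [|| y \in inorder t, lo == Some y | hi == Some y].
Proof.
elim: t lo hi => [|l IHl k r IHr] lo hi //=.
rewrite !mem_cat inE => /or3P[/IHl|/IHr|].
- by case/or3P=> [->|->|/eqP[<-]]; rewrite ?eqxx ?orbT.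
- by case/or3P=> [->|/eqP[<-]|->]; rewrite ?eqxx ?orbT.
- case: ifP => // _ /closing_sub /or3P[] ->; rewrite ?orbT //.
Qed.

(** The induction invariant: both sides of the root are assembled, but the whole gap may still be
    mixed with outside keys until the closing queries of the parent isolate it. *)
Definition split_at lo hi (T t : tree) : Prop :=
  if T is Node l k r then cut lo (Some k) t = l /\ cut (Some k) hi t = r else True.

Lemma node_gaps lo hi l k r : is_bst (Node l k r) ->
    {in inorder (Node l k r), forall y, in_open lo hi y} ->
  {in inorder l, forall y, in_open lo (Some k) y} /\
  {in inorder r, forall y, in_open (Some k) hi y}.
Proof.
move=> /bst_node[_ _ lk rk] mT; split=> y yt.
  have := lk _ yt; have := mT y; rewrite mem_node yt orbT => /(_ isT).
  clear -lo hi; open_lia lo hi.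
have := rk _ yt; have := mT y; rewrite mem_node yt !orbT => /(_ isT).
clear -lo hi; open_lia lo hi.
Qed.

(** Once the gap is isolated, its cut has exactly the keys of [T], and [glue] forces the root of [T]
    on top of the two finished sides. *)
Lemma split_at_iso lo hi T t : is_bst T -> is_bst t ->
    [seq y <- inorder t | in_open lo hi y] = inorder T ->
    split_at lo hi T t -> iso lo hi t ->
  cut lo hi t = T.
Proof.
case: T => [|l k r] bT bt ET /=.
  move=> _ _; apply: cut_leaf => y yt; apply/negP => yo.
  have : y \in [seq y <- inorder t | in_open lo hi y] by rewrite mem_filter yo.
  by rewrite ET.
have : k \in inorder (Node l k r) by rewrite mem_node eqxx.
rewrite -{1}ET mem_filter => /andP[ko kt] [el er] iso_t.
have mT y : y \in inorder (Node l k r) -> in_open lo hi y.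
  by rewrite -ET mem_filter => /andP[].
have [oL oR] := node_gaps bT mT.
rewrite (@glue lo hi k (cut lo hi t)) ?cut_cutl ?cut_cutr ?el ?er //.
- exact: bst_cut.
- exact: mem_cut.
- by rewrite /iso cut_cutl // el.
- by rewrite /iso cut_cutr // er.
Qed.

Lemma split_at_run X T0 lo hi T m Q Z :
    is_bst T0 -> {subset X <= inorder T0} -> is_bst T ->
    {in inorder T, forall y, in_open lo hi y} -> drop m X = Q ++ Z ->
    {in Q, forall y, ~~ in_open lo hi y} ->
  split_at lo hi T (gf_run X T0 m) -> split_at lo hi T (gf_run X T0 (m + size Q)).
Proof.
case: T => // l k r b0 X0 bT mT dX Qo [el er].
have [oL oR] := node_gaps bT mT.
have ko : in_open lo hi k by apply: mT; rewrite mem_node eqxx.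
split; rewrite (cut_gf_run b0 X0 dX) ?/iso ?el ?er // => y /Qo; clear -ko; open_lia lo hi.
Qed.

Lemma filter_node lo hi l k r s : is_bst (Node l k r) ->
    [seq y <- s | in_open lo hi y] = inorder (Node l k r) ->
  [seq y <- s | in_open lo (Some k) y] = inorder l /\
  [seq y <- s | in_open (Some k) hi y] = inorder r.
Proof.
move=> bT E.
have mT y : y \in inorder (Node l k r) -> in_open lo hi y.
  by rewrite -E mem_filter => /andP[].
have ko : in_open lo hi k by apply: mT; rewrite mem_node eqxx.
have [_ _ lk rk] := bst_node bT.
have [oL oR] := node_gaps bT mT.
split.
  transitivity [seq y <- [seq y <- s | in_open lo hi y] | in_open lo (Some k) y].
    rewrite -filter_predI; apply: eq_filter => y /=; clear -ko; open_lia lo hi.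
  rewrite E /= filter_cat /= (all_filterP _); last exact/allP.
  have -> : in_open lo (Some k) k = false by clear -lo hi; open_lia lo hi.
  rewrite (_ : filter _ (inorder r) = [::]) ?cats0 //.
  apply/eqP; rewrite -size_eq0 size_filter -leqn0 leqNgt -has_count.
  by apply/hasPn => y /rk; clear -lo hi; open_lia lo hi.
transitivity [seq y <- [seq y <- s | in_open lo hi y] | in_open (Some k) hi y].
  rewrite -filter_predI; apply: eq_filter => y /=; clear -ko; open_lia lo hi.
rewrite E /= filter_cat /= (_ : filter _ (inorder l) = [::]).
  have -> : in_open (Some k) hi k = false by clear -lo hi; open_lia lo hi.
  by apply/all_filterP/allP.
apply/eqP; rewrite -size_eq0 size_filter -leqn0 leqNgt -has_count.
by apply/hasPn => y /lk; clear -lo hi; open_lia lo hi.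
Qed.

Lemma script_split X T0 : is_bst T0 -> {subset X <= inorder T0} ->
  forall T lo hi m F1 F2, is_bst T ->
    [seq y <- inorder T0 | in_open lo hi y] = inorder T ->
    drop m X = script lo hi T ++ F1 ++ F2 ->
    {in F1, forall y, ~~ in_open lo hi y} ->
    (forall l, lo = Some l -> l \in F1) -> (forall h, hi = Some h -> h \in F1) ->
  split_at lo hi T (gf_run X T0 (m + size (script lo hi T))).
Proof.
move=> b0 X0; elim=> [|l IHl k r IHr] // lo hi m F1 F2 bT ET dX F1o loF hiF.
have bs i : is_bst (gf_run X T0 i) by rewrite bst_gf_run.
have [El Er] := filter_node bT ET; have [bl br lk rk] := bst_node bT.
have mT y : y \in inorder (Node l k r) -> in_open lo hi y.
  by rewrite -ET mem_filter => /andP[].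
have ko : in_open lo hi k by apply: mT; rewrite mem_node eqxx.
have [oL oR] := node_gaps bT mT.
move: dX; rewrite [script _ _ _]/=; case: ifP => [|_].
  (* At a leaf of the target both gaps contain no key, so their cuts are empty without any query. *)
  rewrite /nilp size_cat addn_eq0 !size_eq0 => /andP[/eqP El0 /eqP Er0] _.
  rewrite El0 in El; rewrite Er0 in Er.
  have [-> ->] : l = Leaf /\ r = Leaf.
    by split; apply: inorder_nil.
  have nil p s : [seq y <- inorder T0 | p y] = [::] -> s \in inorder T0 -> ~~ p s.
    by move=> E sT; apply/negP => ps; have : s \in [::]; rewrite // -E mem_filter ps.
  by split; apply: cut_leaf => y; rewrite inorder_gf_run; [apply: nil El|apply: nil Er].
set sl := script _ _ l; set sr := script _ _ r; set cl := closing lo hi k.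
rewrite -!catA => dX.
have slk : k \in cl by rewrite /cl; case: (lo) (hi) => [?|] [?|]; rewrite inE eqxx.
have cl_sub y : y \in cl -> ~~ in_open lo (Some k) y && ~~ in_open (Some k) hi y.
  move/closing_sub; move: ko; clear -lo hi; rewrite /in_open.
  by case: lo hi => [a|] [b|] ko /or3P[] // /eqP; try case=> ?; lia.
have sr_out y : y \in sr -> ~~ in_open lo (Some k) y.
  move/script_sub/or3P => [/oR|/eqP[->]|/eqP]; move: ko; clear -lo hi.
  - by open_lia lo hi.
  - by open_lia lo hi.
  - by rewrite /in_open => ko hiE; subst hi; case: lo ko => [a|] /=; lia.
have drop_cat_ i Q Z : drop i X = Q ++ Z -> drop (i + size Q) X = Z.
  by move=> E; rewrite addnC -drop_drop E drop_size_cat.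
have sub1 y : ~~ in_open lo hi y -> ~~ in_open lo (Some k) y && ~~ in_open (Some k) hi y.
  by clear -ko; open_lia lo hi.
(* The sequel of the left script revisits [lo] within [F1] and [k] within the closing queries. *)
have dl : split_at lo (Some k) l (gf_run X T0 (m + size sl)).
  apply: (IHl lo (Some k) m (sr ++ cl ++ F1) F2) => //.
  - by rewrite -!catA.
  - move=> y; rewrite !mem_cat => /or3P[/sr_out //|/cl_sub /andP[]//|].
    by move/F1o/sub1/andP => [].
  - by move=> x /loF; rewrite !mem_cat => ->; rewrite !orbT.
  - by move=> x [<-]; rewrite !mem_cat slk !orbT.
have dX1 := drop_cat_ _ _ _ dX; have dX2 := drop_cat_ _ _ _ dX1.
have dr : split_at (Some k) hi r (gf_run X T0 (m + size sl + size sr)).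
  apply: (IHr (Some k) hi _ (cl ++ F1) F2) => //.
  - by rewrite -!catA.
  - move=> y; rewrite mem_cat => /orP[/cl_sub /andP[]//|].
    by move/F1o/sub1/andP => [].
  - by move=> x [<-]; rewrite mem_cat slk.
  - by move=> x /hiF; rewrite mem_cat => ->; rewrite orbT.
(* What is assembled on either side survives up to the end of the closing queries, since no query in
   between enters its gap. *)
have {}dl := split_at_run b0 X0 bl oL dX1 sr_out dl.
have {}dl := split_at_run b0 X0 bl oL dX2 (fun y yc => (andP (cl_sub y yc)).1) dl.
have {}dr := split_at_run b0 X0 br oR dX2 (fun y yc => (andP (cl_sub y yc)).2) dr.
have [il ir] := closing_iso b0 X0 ko dX2 F1o loF hiF.
rewrite !size_cat !addnA.
by split; [apply: (split_at_iso bl _ _ dl il)|apply: (split_at_iso br _ _ dr ir)];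
  rewrite ?inorder_gf_run.
Qed.

(** * Script length, height and number of leaves *)

Fixpoint height t := if t is Node l _ r then (maxn (height l) (height r)).+1 else 0.

Fixpoint leaves t :=
  if t is Node l _ r then
    if nilp (inorder l ++ inorder r) then 1 else leaves l + leaves r
  else 0.

Lemma depth_height t : depth t = (height t).-1.
Proof.
elim: t => [|l IHl k r IHr] //=; rewrite IHl IHr.
by case: l {IHl} => [|? ? ?]; case: r {IHr} => [|? ? ?] /=; lia.
Qed.

Lemma nkeys_node l k r : nkeys (Node l k r) = (nkeys l + nkeys r).+1.
Proof. by rewrite /nkeys /= size_cat /= addnS. Qed.

Lemma nilp_node l r : nilp (inorder l ++ inorder r) = (nkeys l + nkeys r == 0).
Proof. by rewrite /nilp size_cat. Qed.

Lemma nkeys_lt_pow t : nkeys t < 2 ^ height t.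
Proof.
elim: t => [|l IHl k r IHr] //; rewrite nkeys_node /= expnS.
have := leq_pexp2l (isT : 0 < 2) (leq_maxl (height l) (height r)).
have := leq_pexp2l (isT : 0 < 2) (leq_maxr (height l) (height r)).
lia.
Qed.

Lemma leaves_gt0 t : 0 < nkeys t -> 0 < leaves t.
Proof.
elim: t => [|l IHl k r IHr] //= _; rewrite nilp_node; case: eqP => //; lia.
Qed.

Lemma leaves_le t : leaves t <= nkeys t.
Proof.
elim: t => [|l IHl k r IHr] //; rewrite nkeys_node /= nilp_node; case: eqP; lia.
Qed.

Lemma nkeys_height1 t : height t <= 1 -> nkeys t <= leaves t.
Proof. by case: t => [|[|? ? ?] k [|? ? ?]] //=; lia. Qed.

Lemma nkeys_height2 t : height t <= 2 -> nkeys t <= 2 * leaves t.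
Proof.
case: t => [|l k r] // ht; rewrite nkeys_node /= nilp_node.
have := @nkeys_height1 l; have := @nkeys_height1 r.
rewrite /= in ht; case: eqP; lia.
Qed.

(* Level i holds at most min (2 ^ i, leaves) nodes; the last three levels are
   bounded by the number of leaves, the others by powers of 2. *)
Lemma nkeys_leaves j t : height t <= j.+3 -> nkeys t < 3 * leaves t + 2 ^ j.
Proof.
elim: t j => [|l IHl k r IHr] j ht; first by rewrite /nkeys /= expn_gt0.
have := @leaves_gt0 (Node l k r); rewrite nkeys_node /= nilp_node in ht *.
case: j ht => [|j] ht.
  have := @nkeys_height2 l; have := @nkeys_height2 r.
  case: eqP; lia.
have := IHl j; have := IHr j; rewrite expnS.
have : 0 < 2 ^ j by rewrite expn_gt0.
case: eqP; lia.
Qed.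

Lemma size_closing lo hi k : size (closing lo hi k) <= 4.
Proof. by case: lo hi => [?|] [?|]. Qed.

(** Leaves cost nothing and other nodes at most four queries; the additive form avoids truncated
    subtraction. *)
Lemma size_script lo hi t : size (script lo hi t) + 4 * leaves t <= 4 * nkeys t.
Proof.
elim: t lo hi => [|l IHl k r IHr] lo hi //.
rewrite nkeys_node /= !size_cat.
have := IHl lo (Some k); have := IHr (Some k) hi; have := size_closing lo hi k.
have := leaves_le l; have := leaves_le r; rewrite nilp_node.
case: eqP => /=; lia.
Qed.

(** At the root both endpoints are infinite, so the closing block has two queries rather than
    four. *)
Lemma size_script_root t : 1 < nkeys t ->
  size (script None None t) + 4 * leaves t + 2 <= 4 * nkeys t.
Proof.
case: t => // l k r; rewrite nkeys_node /= !size_cat nilp_node.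
have := size_script None (Some k) l; have := size_script (Some k) None r.
case: eqP => /=; lia.
Qed.

(** * The two length bounds and the final tree *)

Theorem theorem6 (T : tree) :
  is_bst T ->
  exists S : seq nat,
    [/\ all (fun x => x \in inorder T) S,
        size S <= minn (3 * nkeys T * (depth T + 1 - trunc_log 2 (nkeys T)))
                       (3 * (nkeys T * (nkeys T).-1) %/ 2)
      & forall (T0 : tree) (Y : seq nat),
          inorder T0 = inorder T ->
          all (fun y => y \in inorder T) Y ->
          gf_run (S ++ Y) T0 (size S) = T].
Proof.
move=> bT; exists (script None None T).
have ST x : x \in script None None T -> x \in inorder T.
  by move/script_sub; rewrite /= !orbF.
split; first exact/allP.
- rewrite leq_min depth_height.
  (* With at most one key the second bound is zero, and the script is empty. *)
  have [n1|n1] := leqP (nkeys T) 1.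
    have : size (script None None T) = 0.
      have := size_script None None T; have := leaves_le T.
      by case: (posnP (nkeys T)) => [|/leaves_gt0]; lia.
    by move=> ->.
  have sz := size_script_root n1; have lv := leaves_gt0 (ltnW n1).
  have n_gt0 := ltnW n1.
  have klo := trunc_logP (isT : 1 < 2) n_gt0.
  have kh : trunc_log 2 (nkeys T) < height T.
    by rewrite -(ltn_exp2l _ _ (isT : 1 < 2)) (leq_ltn_trans klo) ?nkeys_lt_pow.
  (* One leaf already gives at most 4n - 6 queries, and 3n^2 - 11n + 12 is positive because its
     discriminant is negative. *)
  apply/andP; split; last by rewrite leq_divRL //; nia.
  move: klo kh; set k := trunc_log _ _ => klo kh.
  (* If the depth exceeds [k], the factor is at least 2 and 6n suffices. Otherwise the depth equals
     [k], the factor is 1, and 3n must be reached by counting leaves. *)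
  have [hk|hk] := leqP (height T) k.+1; last by nia.
  suff : nkeys T <= 4 * leaves T by nia.
  case: k klo kh hk => [|[|k]] klo kh hk.
  + by have := nkeys_height1 hk; lia.
  + by have := nkeys_height2 hk; lia.
  (* Here n is at least 4 times 2^k, so n < 3L + 2^k, with L the number of leaves, yields n < 4L. *)
  + by have := nkeys_leaves hk; rewrite !expnS in klo; lia.
- move=> T0 Y E /allP YT.
  have bT0 : is_bst T0 by rewrite /is_bst E.
  have X0 : {subset script None None T ++ Y <= inorder T0}.
    by move=> x; rewrite mem_cat E => /orP[/ST|/YT].
  have all_in s : [seq y <- s | in_open None None y] = s.
    by apply/all_filterP/allP.
  (* At the root no endpoint has to be revisited, so [F1] is empty and [Y] is arbitrary. *)
  have := @script_split _ _ bT0 X0 T None None 0 [::] Y bT.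
  rewrite all_in drop0 add0n => /(_ E erefl) spl.
  have iso_all t : iso None None t by [].
  rewrite -[LHS](@cut_id None None) //.
  apply: split_at_iso => //; rewrite ?bst_gf_run // ?inorder_gf_run ?all_in //.
  exact: spl.
Qed.
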